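(* Let $h$ be a bounded, self-adjoint, translation invariant operator in $\ell^2(\mathbb{Z})$ and let $Q:\{0,1,2,\dots\}\to\mathbb{R}$ satisfy $\lim_{r\to\infty}Q(r)=0$. For $N\in\mathbb{N}$ let $H_N$ be the $N$-particle Hamiltonian on $\ell^2(\mathbb{Z}^N)$ given by $$H_N=\sum_{i=1}^N h_i+\sum_{1\le i<j\le N}Q_{ij}.$$ Then for any $N\in\mathbb{N}$ and any $m\in\{1,2,\dots,N-1\}$, $$\sigma(H_m)+\sigma(H_{N-m})\subset\sigma(H_N).$$
   Context: Translation invariance of $h$ means $[h,T_x]=0$ for all $x\in\mathbb{Z}$, where $(T_xf)(y)=f(y-x)$. On $\ell^2(\mathbb{Z}^N)=\bigotimes^N\ell^2(\mathbb{Z})$, $h_i$ acts as $h$ on the $i$-th tensor component and as the identity on the other components, and $Q_{ij}$ is the multiplication operator by $Q_{ij}(z)=Q(|z_i-z_j|)$, $z=(z_1,\dots,z_N)\in\mathbb{Z}^N$. The same $h$ and $Q$ are used for all particle numbers. For sets $A,B\subset\mathbb{R}$, $A+B=\{a+b:a\in A,b\in B\}$. *)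

(* Defs.v *)
From HB Require Import structures.
From mathcomp Require Import all_boot all_order all_algebra.
From mathcomp Require Import complex ring lra.
From mathcomp Require Import all_classical all_reals all_analysis.

Set Implicit Arguments.
Unset Strict Implicit.
Unset Printing Implicit Defensive.

Import Order.TTheory GRing.Theory Num.Theory.
Import numFieldNormedType.Exports.
Import Normc.

Local Open Scope classical_set_scope.
Local Open Scope complex_scope.
Local Open Scope ring_scope.

Lemma normc_ge0 (R : realType) (z : R[i]) : 0 <= normc z.
Proof. by case: z => a b; rewrite sqrtr_ge0. Qed.

Lemma normcD_sqr (R : realType) (x y : R[i]) :
  normc (x + y) ^+ 2 <= 2 * normc x ^+ 2 + 2 * normc y ^+ 2.
Proof.
have h := le_normcD x y.
apply: (@le_trans _ _ ((normc x + normc y) ^+ 2)).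
  by rewrite lerXn2r// nnegrE ?addr_ge0 ?normc_ge0.
rewrite -subr_ge0.
rewrite [X in 0 <= X](_ : _ = (normc x - normc y) ^+ 2) ?sqr_ge0//.
by ring.
Qed.

Lemma esum_leZ (R : realType) (I : choiceType) (D : set I) (a b : I -> \bar R)
    (c : R) :
  0 <= c -> (forall i, (0 <= b i)%E) -> (forall i, (a i <= c%:E * b i)%E) ->
  (\esum_(i in D) a i <= c%:E * \esum_(i in D) b i)%E.
Proof.
move=> c0 b0 ab; apply: ge_ereal_sup => _ [X [finX XD] <-].
apply: (@le_trans _ _ (\sum_(i \in X) c%:E * b i)%E); first exact: lee_fsum.
rewrite -ge0_mule_fsumr//; apply: lee_wpmul2l; first by rewrite lee_fin.
by apply: ereal_sup_ubound; exists X.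
Qed.

Section ell2_space.
Variables (R : realType) (I : choiceType).
Implicit Types (f g : I -> R[i]) (c : R[i]).

Definition sqsum f : \bar R := \esum_(i in [set: I]) (normc (f i) ^+ 2)%:E.

Definition square_summable : {pred I -> R[i]} := fun f => (sqsum f < +oo)%E.

Lemma sqsum_ge0 f : (0 <= sqsum f)%E.
Proof. by apply: esum_ge0 => i _; rewrite lee_fin sqr_ge0. Qed.

Lemma sqsum_le f g (M : R) : 0 <= M ->
  (forall i, normc (f i) <= M * normc (g i)) ->
  (sqsum f <= (M ^+ 2)%:E * sqsum g)%E.
Proof.
move=> M0 fg; apply: esum_leZ => [|i|i]; rewrite ?lee_fin ?sqr_ge0//.
by rewrite -exprMn lerXn2r// nnegrE ?mulr_ge0 ?normc_ge0.
Qed.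

Lemma square_summable_le f g (M : R) : 0 <= M ->
  (forall i, normc (f i) <= M * normc (g i)) ->
  g \in square_summable -> f \in square_summable.
Proof.
move=> M0 /(sqsum_le M0) fg gS; apply: le_lt_trans fg _.
by rewrite lte_mul_pinfty// lee_fin sqr_ge0.
Qed.

Lemma square_summable_submod : submod_closed square_summable.
Proof.
split=> [|c f g fS gS].
  by rewrite unfold_in /square_summable /sqsum esum1// => i _; rewrite normc0 expr0n.
have cfS : c *: f \in square_summable.
  apply: (square_summable_le (normc_ge0 c) _ fS) => i.
  by rewrite -normcM.
have le2 : (sqsum ((c *: f) + g)%R <= 2%:E * (sqsum (c *: f)%R + sqsum g))%E.
  rewrite /sqsum -esumD => [|i _|i _]; rewrite ?lee_fin ?sqr_ge0//.
  apply: esum_leZ => [//|i|i]; rewrite -EFinD lee_fin.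
    by rewrite addr_ge0 ?sqr_ge0.
  by rewrite mulrDr; exact: normcD_sqr.
apply: le_lt_trans le2 _; apply: lte_mul_pinfty => //.
exact: lte_add_pinfty.
Qed.

HB.instance Definition _ :=
  GRing.isSubmodClosed.Build _ _ square_summable square_summable_submod.

Record ell2 := Ell2 { ell2_val :> I -> R[i] ; _ : ell2_val \in square_summable }.

HB.instance Definition _ := [isSub for ell2_val].
HB.instance Definition _ := [Choice of ell2 by <:].
HB.instance Definition _ := [SubChoice_isSubLmodule of ell2 by <:].

End ell2_space.

Arguments ell2 R I : clear implicits.

Lemma ell2P (R : realType) (I : choiceType) (f g : ell2 R I) :
  (forall i, f i = g i) -> f = g.
Proof. by move=> fg; apply/val_inj/funext. Qed.

Section operators.
Variables (R : realType) (I : choiceType).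
Implicit Types (f g : ell2 R I) (A B : {linear ell2 R I -> ell2 R I}).

Definition ell2_norm f : R := Num.sqrt (fine (sqsum f)).

(* The sum of an absolutely summable real family, as the difference of the sums
   of its positive and negative parts. *)
Definition real_sum (u : I -> R) : R :=
  fine (\esum_(i in [set: I]) (Num.max (u i) 0)%:E) -
  fine (\esum_(i in [set: I]) (Num.max (- u i) 0)%:E).

Definition ell2_dot f g : R[i] :=
  real_sum (fun i => complex.Re ((f i)^* * g i)) +i*
  real_sum (fun i => complex.Im ((f i)^* * g i)).

Definition bounded_op A : Prop :=
  exists M : R, forall f, ell2_norm (A f) <= M * ell2_norm f.

Definition self_adjoint A : Prop :=
  forall f g, ell2_dot (A f) g = ell2_dot f (A g).

Definition resolvent_set A : set R[i] :=
  [set l | exists B, [/\ bounded_op B,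
     forall f, B (A f - l *: f) = f & forall f, A (B f) - l *: B f = f]].

Definition spectrum A : set R[i] := ~` resolvent_set A.

Lemma sqsum_fin_num f : sqsum f \is a fin_num.
Proof. by rewrite ge0_fin_numE ?sqsum_ge0//; exact: (valP f). Qed.

Lemma bounded_op_sqsum A : bounded_op A ->
  exists2 M : R, 0 <= M & forall f, (sqsum (A f) <= M%:E * sqsum f)%E.
Proof.
move=> [M AM]; exists (`|M| ^+ 2); rewrite ?sqr_ge0// => f.
have fS (g : ell2 R I) : sqsum g = (ell2_norm g ^+ 2)%:E.
  by rewrite sqr_sqrtr ?fine_ge0 ?sqsum_ge0// fineK// sqsum_fin_num.
rewrite !fS -EFinM lee_fin -exprMn lerXn2r ?nnegrE ?mulr_ge0 ?sqrtr_ge0//.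
by apply: le_trans (AM f) _; rewrite ler_wpM2r ?sqrtr_ge0 ?ler_norm.
Qed.

Lemma ell2_dotff f : ell2_dot f f = (ell2_norm f ^+ 2)%:C.
Proof.
rewrite sqr_sqrtr ?fine_ge0 ?sqsum_ge0// /ell2_dot /real_sum.
have fRe i : complex.Re ((f i)^* * f i) = normc (f i) ^+ 2.
  case: (f i) => a b /=; rewrite sqr_sqrtr ?addr_ge0 ?sqr_ge0//.
  by ring.
have fIm i : complex.Im ((f i)^* * f i) = 0.
  by case: (f i) => a b /=; ring.
congr (_ +i* _).
  rewrite [X in _ - fine X]esum1 => [|i _].
    rewrite subr0; congr fine; apply: eq_esum => i _.
    by rewrite fRe max_l ?sqr_ge0.
  by rewrite fRe max_r ?oppr_le0 ?sqr_ge0.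
by rewrite !esum1 ?subrr// => i _; rewrite fIm ?oppr0 maxxx.
Qed.

Section multiplication.
Variables (V : I -> R) (Vb : exists M : R, forall i, `|V i| <= M).

Lemma mul_op_subproof f : (fun i => (V i)%:C * f i) \in @square_summable R I.
Proof.
case: Vb => M VM; apply: (@square_summable_le _ _ _ f `|M|) (valP f) => // i.
rewrite normcM ler_wpM2r ?normc_ge0// /normc/= expr0n/= addr0 sqrtr_sqr.
by rewrite (le_trans (VM i))// ler_norm.
Qed.

Definition mul_op f : ell2 R I := Ell2 (mul_op_subproof f).

Lemma mul_op_linear : linear mul_op.
Proof.
move=> c f g; apply: ell2P => i /=.
by rewrite !fctE /= mulrDr; congr (_ + _); rewrite /GRing.scale/= mulrCA.
Qed.

HB.instance Definition _ := GRing.isLinear.Build _ _ _ _ mul_op mul_op_linear.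
End multiplication.
End operators.

Section translation.
Variable R : realType.

Lemma translate_subproof (x : int) (f : ell2 R int) :
  (fun y => f (y - x)) \in @square_summable R int.
Proof.
rewrite /square_summable unfold_in /sqsum.
rewrite -(@reindex_esum R _ _ setT setT (fun y : int => y - x)
  (fun y => (normc (f y) ^+ 2)%:E)); first exact: (valP f).
split=> //; first by move=> y z _ _ /addIr.
by move=> y _; exists (y + x) => //; rewrite addrK.
Qed.

Definition translate (x : int) (f : ell2 R int) : ell2 R int :=
  Ell2 (translate_subproof x f).

Definition translation_invariant (A : {linear ell2 R int -> ell2 R int}) : Prop :=
  forall x f, A (translate x f) = translate x (A f).

End translation.

Section one_body.
Variables (R : realType) (N : nat) (i : 'I_N).
Local Notation config := {ffun 'I_N -> int}.

Definition update (z : config) (x : int) : config :=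
  [ffun k => if k == i then x else z k].

Lemma updateE z x : update z x i = x. Proof. by rewrite ffunE eqxx. Qed.

Lemma update_update z x y : update (update z x) y = update z y.
Proof. by apply/ffunP => k; rewrite !ffunE; case: eqP. Qed.

Lemma update_id z : update z (z i) = z.
Proof. by apply/ffunP => k; rewrite !ffunE; case: eqP => // ->. Qed.

Lemma slice_subproof (f : ell2 R config) (z : config) :
  (fun x => f (update z x)) \in @square_summable R int.
Proof.
have ui : set_inj [set: int] (update z).
  by move=> x y _ _ /(congr1 (fun w : config => w i)); rewrite !updateE.
rewrite /square_summable unfold_in /sqsum.
rewrite -(@esum_image R _ _ setT (update z) (fun w => (normc (f w) ^+ 2)%:E))//.
apply: le_lt_trans (valP f); rewrite /sqsum [leRHS](esumID (update z @` setT)).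
  rewrite setTI leeDl// esum_ge0// => w _.
  by rewrite lee_fin sqr_ge0.
by move=> w _; rewrite lee_fin sqr_ge0.
Qed.

(* The function x |-> f (z_1, .., z_(i-1), x, z_(i+1), .., z_N). *)
Definition slice (f : ell2 R config) (z : config) : ell2 R int :=
  Ell2 (slice_subproof f z).

Lemma slice_update f z x : slice f (update z x) = slice f z.
Proof. by apply: ell2P => y /=; rewrite update_update. Qed.

Lemma slice_linear c f g z : slice (c *: f + g) z = c *: slice f z + slice g z.
Proof. by apply: ell2P. Qed.

Lemma esum_slices (a : config -> \bar R) : (forall z, (0 <= a z)%E) ->
  \esum_(z in [set: config]) a z =
  \esum_(w in [set w : config | w i = 0]) \esum_(x in [set: int]) a (update w x).
Proof.
move=> a0; rewrite esum_esum//.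
rewrite (@reindex_esum _ _ _ ([set w : config | w i = 0] `*`` (fun=> [set: int]))
  setT (fun p => update p.1 p.2))//; split=> //.
- move=> [w x] [w' x']; rewrite !inE/= => -[w0 _] [w'0 _] e.
  have ex : x = x' by rewrite -(updateE w x) e updateE.
  congr (_, _) => //.
  rewrite -(update_id w) -(update_id w') w0 w'0.
  by rewrite -(update_update w x) e update_update.
- move=> z _; exists (update z 0, z i) => /=; first by rewrite updateE.
  by rewrite update_update update_id.
Qed.

Variables (h : {linear ell2 R int -> ell2 R int}) (hb : bounded_op h).

Lemma one_body_subproof (f : ell2 R config) :
  (fun z => h (slice f z) (z i)) \in @square_summable R config.
Proof.
have [M M0 hM] := bounded_op_sqsum hb.
have fS : (sqsum f < +oo)%E := valP f.
rewrite /square_summable unfold_in /sqsum esum_slices; last first.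
  by move=> z; rewrite lee_fin sqr_ge0.
apply: (@le_lt_trans _ _ (M%:E * sqsum f)%E); last by rewrite lte_mul_pinfty.
rewrite [sqsum f]esum_slices; last by move=> z; rewrite lee_fin sqr_ge0.
apply: esum_leZ => // w; first by rewrite -/(sqsum (slice f w)) sqsum_ge0.
apply: le_trans (hM (slice f w)).
by apply: le_esum => x _; rewrite slice_update updateE.
Qed.

(* Under the identification of l^2(Z^N) with the N-fold tensor power of l^2(Z),
   this is 1 (x) .. (x) h (x) .. (x) 1 with h in position i: in the variable z_i
   the function f is acted on by h, the other variables being parameters. *)
Definition one_body (f : ell2 R config) : ell2 R config :=
  Ell2 (one_body_subproof f).

Lemma one_body_linear : linear one_body.
Proof. by move=> c f g; apply: ell2P => z /=; rewrite slice_linear linearP. Qed.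

HB.instance Definition _ :=
  GRing.isLinear.Build _ _ _ _ one_body one_body_linear.
End one_body.

Section hamiltonian.
Variables (R : realType) (h : {linear ell2 R int -> ell2 R int}).
Variables (hb : bounded_op h) (Q : nat -> R) (Q0 : Q n @[n --> \oo] --> 0).

Lemma pair_potential_bounded N (i j : 'I_N) :
  exists M : R, forall z : {ffun 'I_N -> int}, `|Q `|z i - z j|%N| <= M.
Proof.
have [M [_ QM]] : bounded_fun Q by apply/cvg_seq_bounded/cvg_ex; exists 0.
by exists (M + 1) => z; apply: QM => //; rewrite ltrDl.
Qed.

Definition pair_interaction N (i j : 'I_N) :
    ell2 R {ffun 'I_N -> int} -> ell2 R {ffun 'I_N -> int} :=
  mul_op (pair_potential_bounded i j).

HB.instance Definition _ N (i j : 'I_N) := GRing.Linear.on (pair_interaction i j).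

Definition hamiltonian N (f : ell2 R {ffun 'I_N -> int}) :
    ell2 R {ffun 'I_N -> int} :=
  \sum_(i < N) one_body i hb f +
  \sum_(i < N) \sum_(j < N | (i < j)%N) pair_interaction i j f.

Lemma hamiltonian_linear N : linear (@hamiltonian N).
Proof.
move=> c f g; rewrite /hamiltonian scalerDr !scaler_sumr addrACA; congr (_ + _).
  by rewrite -big_split; apply: eq_bigr => i _; rewrite linearP.
rewrite -big_split; apply: eq_bigr => i _ /=.
by rewrite scaler_sumr -big_split; apply: eq_bigr => j _; rewrite linearP.
Qed.

HB.instance Definition _ N :=
  GRing.isLinear.Build _ _ _ _ (@hamiltonian N) (@hamiltonian_linear N).
End hamiltonian.

Arguments hamiltonian {R h} hb {Q} Q0 N f.

(* Main.v *)
(* For a bounded symmetric operator A, the spectrum consists of the approximate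
   eigenvalues: if T = A - l is bounded below then so is T' = A - l^*, because T
   is normal, and T T' w = v is solved by iterating a contraction.  Approximate
   eigenvectors f and g of H_m and H_(N-m) can be taken finitely supported.
   Translating g by a large x changes neither its norm nor its being an
   approximate eigenvector, while it makes the two clusters so distant that the
   interaction between them is negligible on f (x) T_x g, which is therefore an
   approximate eigenvector of H_N for the sum of the two eigenvalues. *)
From HB Require Import structures.
Require Import Defs.
From mathcomp Require Import all_boot all_order all_algebra.
From mathcomp Require Import complex ring lra zify.
From mathcomp Require Import all_classical all_reals all_analysis.

Import Order.TTheory GRing.Theory Num.Theory.
Import numFieldNormedType.Exports.
Import Normc.

Set Implicit Arguments.
Unset Strict Implicit.

Local Open Scope classical_set_scope.
Local Open Scope ring_scope.

(** * Norm and real inner product *)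

Section norm.
Context {R : realType} {I : choiceType}.
Implicit Types (f g k : ell2 R I) (c : R[i]).

(** The operations are pointwise by conversion; the triple is a rewrite rule that brings a goal down
    to coordinates. *)
Lemma ell2E : (forall (u v : I -> R[i]) i, (u + v) i = u i + v i) *
  (forall (u : I -> R[i]) i, (- u) i = - u i) *
  (forall c (u : I -> R[i]) i, (c *: u) i = c * u i).
Proof. by []. Qed.

Lemma normc_sqr c : normc c ^+ 2 = complex.Re c ^+ 2 + complex.Im c ^+ 2.
Proof. by case: c => a b /=; rewrite sqr_sqrtr// addr_ge0 ?sqr_ge0. Qed.

Lemma sqsumE f : sqsum f = (ell2_norm f ^+ 2)%:E.
Proof.
by rewrite sqr_sqrtr ?fine_ge0 ?sqsum_ge0// fineK// sqsum_fin_num.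
Qed.

Lemma ell2_norm_ge0 f : 0 <= ell2_norm f.
Proof. exact: sqrtr_ge0. Qed.

Lemma ell2_norm_le1 (M : R) f g : 0 <= M ->
  (forall i, normc (f i) <= M * normc (g i)) ->
  ell2_norm f <= M * ell2_norm g.
Proof.
move=> M0 fg; have := sqsum_le M0 fg; rewrite !sqsumE -EFinM lee_fin -exprMn.
by rewrite ler_pXn2r// nnegrE ?mulr_ge0 ?ell2_norm_ge0.
Qed.

Lemma ell2_norm_coord f i : normc (f i) <= ell2_norm f.
Proof.
rewrite -(@ler_pXn2r _ 2)// ?nnegrE ?normc_ge0 ?ell2_norm_ge0//.
rewrite -lee_fin -sqsumE /sqsum.
rewrite -(@esum_set1 _ _ i (fun i => (normc (f i) ^+ 2)%:E)); last first.
  by rewrite lee_fin sqr_ge0.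
rewrite [leRHS](esumID [set i]) ?setTI; last by move=> *; rewrite lee_fin sqr_ge0.
by rewrite leeDl// esum_ge0// => *; rewrite lee_fin sqr_ge0.
Qed.

Lemma ell2_norm_eq0 f : ell2_norm f = 0 -> f = 0.
Proof.
move=> f0; apply: ell2P => i; apply: eq0_normc; apply: le_anti.
by rewrite normc_ge0 andbT -f0 ell2_norm_coord.
Qed.

Lemma ell2_norm0 : ell2_norm (0 : ell2 R I) = 0.
Proof.
apply: le_anti; rewrite ell2_norm_ge0 andbT.
have := @ell2_norm_le1 0 0 0 (lexx _); rewrite mul0r; apply=> i.
by rewrite normc0 mul0r.
Qed.

Lemma ell2_normZ c f : ell2_norm (c *: f) = normc c * ell2_norm f.
Proof.
apply: le_anti; apply/andP; split.
  by apply: ell2_norm_le1 => [|i]; rewrite ?normc_ge0 ?normcM.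
have [->|c0] := eqVneq c 0; first by rewrite normc0 mul0r ell2_norm_ge0.
have nc0 : 0 < normc c.
  by rewrite lt_def normc_ge0 andbT; apply: contra c0 => /eqP/eq0_normc ->.
rewrite -ler_pdivlMl//; apply: ell2_norm_le1 => [|i].
  by rewrite invr_ge0 ltW.
by rewrite normcM mulKf// gt_eqF.
Qed.

Lemma ell2_normN f : ell2_norm (- f) = ell2_norm f.
Proof.
by rewrite -scaleN1r ell2_normZ /normc/= oppr0 sqrrN expr1n expr0n addr0 sqrtr1 mul1r.
Qed.

Lemma ell2_normB f g : ell2_norm (f - g) = ell2_norm (g - f).
Proof. by rewrite -opprB ell2_normN. Qed.

Lemma normc_real (r : R) : normc (real_complex R r) = `|r|.
Proof. by rewrite /normc/= expr0n addr0 sqrtr_sqr. Qed.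

(* The weights may be negative: both parts of the sum of the squares are finite,
   so the negative weights can be moved to the other side of the inequality. *)
Lemma ell2_norm_comb (s : seq (R * ell2 R I)) :
  (forall i, 0 <= \sum_(p <- s) p.1 * normc (p.2 i) ^+ 2) ->
  0 <= \sum_(p <- s) p.1 * ell2_norm p.2 ^+ 2.
Proof.
move=> s0.
have E (u : R -> R) : (forall x, 0 <= u x) ->
    (\sum_(p <- s) u p.1 * ell2_norm p.2 ^+ 2)%:E =
    \esum_(i in [set: I]) (\sum_(p <- s) u p.1 * normc (p.2 i) ^+ 2)%:E.
  move=> u0; under eq_esum do rewrite -sumEFin.
  rewrite esum_sum => [|*]; last by rewrite lee_fin mulr_ge0 ?sqr_ge0.
  rewrite -sumEFin; apply: eq_bigr => -[w f] _ /=.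
  (* A nonnegative weight is absorbed into its vector as the scalar [sqrt (u w)]. *)
  pose c := real_complex R (Num.sqrt (u w)).
  have cE : normc c ^+ 2 = u w by rewrite normc_real real_normK ?num_real ?sqr_sqrtr.
  rewrite -{1}cE -exprMn -ell2_normZ -sqsumE; apply: eq_esum => i _.
  by rewrite normcM exprMn cE.
have wE (w : R) : w = Num.max w 0 - Num.max (- w) 0.
  by case: (leP w 0) => w0; [rewrite max_l ?oppr_ge0// sub0r opprK|
    rewrite max_r ?subr0// oppr_le0 ltW].
under eq_bigr do rewrite [_.1 in X in X * _]wE mulrBl.
rewrite sumrB subr_ge0 -lee_fin.
rewrite (E (fun w => Num.max w 0)) ?(E (fun w => Num.max (- w) 0)); last 2 first.
- by move=> x; rewrite le_max lexx orbT.
- by move=> x; rewrite le_max lexx orbT.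
apply: le_esum => i _; rewrite lee_fin -subr_ge0 -sumrB.
under eq_bigr do rewrite -mulrBl -wE.
exact: s0.
Qed.

(** Follows from the inequality for the given weights and for their opposites. It turns a
    coordinatewise identity between squared moduli into one between squared norms. *)
Lemma ell2_norm_comb0 (s : seq (R * ell2 R I)) :
  (forall i, \sum_(p <- s) p.1 * normc (p.2 i) ^+ 2 = 0) ->
  \sum_(p <- s) p.1 * ell2_norm p.2 ^+ 2 = 0.
Proof.
move=> s0; apply/eqP; rewrite eq_le; apply/andP; split; last first.
  by apply: ell2_norm_comb => i; rewrite s0.
rewrite -oppr_ge0 -sumrN.
have := @ell2_norm_comb [seq (- p.1, p.2) | p <- s]; rewrite big_map /=.
under eq_bigr do rewrite mulNr.
apply=> i; rewrite big_map; under eq_bigr do rewrite mulNr.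
by rewrite sumrN s0 oppr0.
Qed.

(** With [a] and [b] the two norms, the coordinatewise identity [b (a + b) |f|^2 + a (a + b) |g|^2 -
    a b |f + g|^2 = |b f - a g|^2 >= 0] sums to [a b (a + b)^2 >= a b |f + g|^2]. Zero norms are
    treated first, so that [a b] cancels. *)
Lemma ell2_normD f g : ell2_norm (f + g) <= ell2_norm f + ell2_norm g.
Proof.
set a := ell2_norm f; set b := ell2_norm g.
have [a0|a0] := eqVneq a 0.
  by rewrite (ell2_norm_eq0 a0) add0r a0 add0r.
have [b0|b0] := eqVneq b 0.
  by rewrite (ell2_norm_eq0 b0) addr0 b0 addr0.
have {}a0 : 0 < a by rewrite lt_def a0 ell2_norm_ge0.
have {}b0 : 0 < b by rewrite lt_def b0 ell2_norm_ge0.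
rewrite -(@ler_pXn2r _ 2)// ?nnegrE ?addr_ge0 ?ell2_norm_ge0//.
rewrite -(ler_pM2l (mulr_gt0 a0 b0)).
have H := @ell2_norm_comb [:: (- (a * b), f + g); (b * (a + b), f); (a * (a + b), g)].
rewrite !big_cons !big_nil /= -/a -/b in H.
lapply H; first by clear H; move: (ell2_norm _) => ?; lra.
move=> i; rewrite !big_cons !big_nil /=.
rewrite !ell2E.
case: (f i) (g i) => [x y] [z t]; rewrite !normc_sqr /=.
rewrite [leRHS](_ : _ = (b * x - a * z) ^+ 2 + (b * y - a * t) ^+ 2); last by ring.
by rewrite addr_ge0 ?sqr_ge0.
Qed.

(* Polarization: symmetry of an operator becomes an identity between norms, which
   passes to slices by summing nonnegative families only. *)
Definition rdot f g : R := (ell2_norm (f + g) ^+ 2 - ell2_norm (f - g) ^+ 2) / 4.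

(** With [P] and [M] half the sum and half the difference, each summand [u i] equals
    [|P i|^2 - |M i|^2]. Hence the positive and negative parts of [u] have sums at most [|P|^2] and
    [|M|^2], so [fine] acts on finite values, and the equation can be rearranged as
    [u^+ + |M|^2 = u^- + |P|^2] and summed. *)
Lemma rdotE f g : rdot f g = complex.Re (ell2_dot f g).
Proof.
pose u i := complex.Re (conjc (f i) * g i).
pose hc := real_complex R (2^-1).
pose P := hc *: (f + g); pose M := hc *: (f - g).
have PE : ell2_norm P ^+ 2 = ell2_norm (f + g) ^+ 2 / 4.
  by rewrite ell2_normZ normc_real ger0_norm ?invr_ge0// exprMn; field.
have ME : ell2_norm M ^+ 2 = ell2_norm (f - g) ^+ 2 / 4.
  by rewrite ell2_normZ normc_real ger0_norm ?invr_ge0// exprMn; field.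
have uE i : u i = normc (P i) ^+ 2 - normc (M i) ^+ 2.
  rewrite /u /= !ell2E !normc_sqr /=.
  by case: (f i) (g i) => [x y] [z t] /=; field.
have le1 : (\esum_(i in [set: I]) (Num.max (u i) 0)%:E <= sqsum P)%E.
  apply: le_esum => i _; rewrite lee_fin ge_max sqr_ge0 andbT uE.
  by rewrite gerBl sqr_ge0.
have le2 : (\esum_(i in [set: I]) (Num.max (- u i) 0)%:E <= sqsum M)%E.
  apply: le_esum => i _; rewrite lee_fin ge_max sqr_ge0 andbT uE.
  by rewrite opprB gerBl sqr_ge0.
have eq12 : (\esum_(i in [set: I]) (Num.max (u i) 0)%:E + sqsum M =
             \esum_(i in [set: I]) (Num.max (- u i) 0)%:E + sqsum P)%E.
  rewrite /sqsum -!esumD => [|*|*|*|*]; rewrite ?lee_fin ?le_max ?lexx ?orbT ?sqr_ge0//.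
  apply: eq_esum => i _; rewrite -!EFinD; congr EFin; rewrite uE.
  move: (normc _ ^+ 2) (normc _ ^+ 2) => p m.
  by case: (leP (m - p) 0); case: (leP (- (m - p)) 0); lra.
have fin1 : (\esum_(i in [set: I]) (Num.max (u i) 0)%:E)%E \is a fin_num.
  rewrite ge0_fin_numE; first by apply: le_lt_trans le1 _; rewrite sqsumE ltry.
  by apply: esum_ge0 => *; rewrite lee_fin le_max lexx orbT.
have fin2 : (\esum_(i in [set: I]) (Num.max (- u i) 0)%:E)%E \is a fin_num.
  rewrite ge0_fin_numE; first by apply: le_lt_trans le2 _; rewrite sqsumE ltry.
  by apply: esum_ge0 => *; rewrite lee_fin le_max lexx orbT.
rewrite /ell2_dot /= /real_sum -/u /rdot mulrBl -PE -ME.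
move: eq12; rewrite !sqsumE -(fineK fin1) -(fineK fin2) -!EFinD => -[].
by case=> E; lra.
Qed.

Lemma rdotDl f g k : rdot (f + g) k = rdot f k + rdot g k.
Proof.
(* For arbitrary vectors, an identity between squared moduli transfers to squared norms; [ring] then
   checks it on coordinates. *)
have gen (a1 a2 a3 a4 a5 a6 : ell2 R I) :
    (forall i, normc (a1 i) ^+ 2 - normc (a2 i) ^+ 2 =
       normc (a3 i) ^+ 2 - normc (a4 i) ^+ 2 +
       (normc (a5 i) ^+ 2 - normc (a6 i) ^+ 2)) ->
    (ell2_norm a1 ^+ 2 - ell2_norm a2 ^+ 2) / 4 =
    (ell2_norm a3 ^+ 2 - ell2_norm a4 ^+ 2) / 4 +
    (ell2_norm a5 ^+ 2 - ell2_norm a6 ^+ 2) / 4.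
  move=> E; have := @ell2_norm_comb0 [:: (1, a1); (-1, a2); (-1, a3); (1, a4);
    (-1, a5); (1, a6)].
  rewrite !big_cons !big_nil /= => H; lapply H; first by lra.
  by move=> i; rewrite !big_cons !big_nil /=; have := E i; lra.
apply: gen => i; rewrite /= !ell2E.
by case: (f i) (g i) (k i) => [x y] [z t] [u v]; rewrite !normc_sqr /=; ring.
Qed.

Lemma rdotC f g : rdot f g = rdot g f.
Proof. by rewrite /rdot (addrC f) ell2_normB. Qed.

Lemma rdotff f : rdot f f = ell2_norm f ^+ 2.
Proof.
rewrite /rdot subrr ell2_norm0 -mulr2n -scaler_nat ell2_normZ.
rewrite -(rmorph_nat (real_complex R)) normc_real ger0_norm//; lra.
Qed.

Lemma rdotNl f g : rdot (- f) g = - rdot f g.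
Proof.
have -> : rdot (- f) g = (ell2_norm (- (f - g)) ^+ 2 - ell2_norm (- (f + g)) ^+ 2) / 4.
  by rewrite /rdot opprB [- (f + g)]opprD (addrC g).
by rewrite !ell2_normN /rdot -[RHS]mulNr opprB.
Qed.

Lemma rdotDr f g k : rdot f (g + k) = rdot f g + rdot f k.
Proof. by rewrite rdotC rdotDl !(rdotC f). Qed.

Lemma rdotNr f g : rdot f (- g) = - rdot f g.
Proof. by rewrite rdotC rdotNl rdotC. Qed.

Lemma rdot_ext (f g f' g' : ell2 R I) :
  (forall i, complex.Re (conjc (f i) * g i) = complex.Re (conjc (f' i) * g' i)) ->
  rdot f g = rdot f' g'.
Proof.
move=> E; rewrite !rdotE /=; congr (fine _ - fine _);
  by apply: eq_esum => i _; rewrite E.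
Qed.

Lemma rdotZ c f g : rdot (c *: f) g = rdot f (conjc c *: g).
Proof.
apply: rdot_ext => i; rewrite /= !ell2E.
by case: c (f i) (g i) => [x y] [z t] [u v] /=; ring.
Qed.

(** The expansion behind the contraction estimate, where the step size [r] is real. *)
Lemma ell2_normBZ_sqr (r : R) f g :
  ell2_norm (f - real_complex R r *: g) ^+ 2 =
  ell2_norm f ^+ 2 - 2 * r * rdot f g + r ^+ 2 * ell2_norm g ^+ 2.
Proof.
have gen (a1 a2 a3 : ell2 R I) :
    (forall i, normc (a1 i) ^+ 2 = normc (f i) ^+ 2 -
       2 * r * ((normc (a2 i) ^+ 2 - normc (a3 i) ^+ 2) / 4)
       + r ^+ 2 * normc (g i) ^+ 2) ->
    ell2_norm a1 ^+ 2 = ell2_norm f ^+ 2 -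
      2 * r * ((ell2_norm a2 ^+ 2 - ell2_norm a3 ^+ 2) / 4) +
      r ^+ 2 * ell2_norm g ^+ 2.
  move=> E; have := @ell2_norm_comb0 [:: (1, a1); (-1, f); (r / 2, a2);
    (- (r / 2), a3); (- r ^+ 2, g)].
  rewrite !big_cons !big_nil /= => H; lapply H; first by lra.
  by move=> i; rewrite !big_cons !big_nil /=; have := E i; lra.
apply: gen => i; rewrite /= !ell2E.
by case: (f i) (g i) => [x y] [z t]; rewrite !normc_sqr /=; field.
Qed.
End norm.

(** * Completeness *)

Lemma subrACA (V : zmodType) (a b c d : V) : a - b - (c - d) = a - c - (b - d).
Proof. by rewrite !opprD !opprK addrACA. Qed.

Section geometric.
Variable R : realType.

Lemma le0_geometric (q C x : R) : 0 <= q < 1 ->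
  (forall n, x <= C * q ^+ n) -> x <= 0.
Proof.
move=> /andP[q0 q1] H; rewrite -(mulr0 C).
have : C * q ^+ n @[n --> \oo] --> C * 0.
  by apply: cvgMr; apply: cvg_expr; rewrite ger0_norm.
by move=> /cvgr_to_ge; apply; apply: nearW.
Qed.

Lemma geometric_cvg (q D : R) (x : nat -> R) : 0 <= q < 1 ->
  (forall n k, `|x (n + k)%N - x n| <= D * q ^+ n) -> cvgn x.
Proof.
move=> /andP[q0 q1] H; apply/cauchy_cvgP/cauchy_exP => e e0.
have : D * q ^+ n @[n --> \oo] --> D * 0.
  by apply: cvgMr; apply: cvg_expr; rewrite ger0_norm.
rewrite mulr0 => /cvgr_lt /(_ _ e0) [n _ /(_ _ (leqnn n)) ne].
exists (x n); exists n => // k nk; rewrite /= /ball/= distrC.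
by apply: le_lt_trans ne; rewrite -(subnKC nk).
Qed.

Lemma cvg_sumr (I : eqType) (s : seq I) (F : I -> nat -> R) (l : I -> R) :
  (forall i, F i k @[k --> \oo] --> l i) ->
  \sum_(i <- s) F i k @[k --> \oo] --> \sum_(i <- s) l i.
Proof.
move=> H; elim: s => [|i s IH].
  by rewrite big_nil; under eq_cvg do rewrite big_nil; exact: cvg_cst.
by rewrite big_cons; under eq_cvg do rewrite big_cons; exact: cvgD.
Qed.

End geometric.

Section complete.
Context {R : realType} {I : choiceType}.
Implicit Types (f g : ell2 R I).

Lemma ell2_telescope (u : nat -> ell2 R I) (q C : R) : 0 <= q < 1 ->
  (forall n, ell2_norm (u n.+1 - u n) <= C * q ^+ n) ->
  forall n k, ell2_norm (u (n + k)%N - u n) <= C / (1 - q) * q ^+ n.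
Proof.
move=> /andP[q0 q1] H n k.
have q1' : 1 - q != 0 by rewrite subr_eq0 gt_eqF.
have C0 : 0 <= C by have := le_trans (ell2_norm_ge0 _) (H 0%N); rewrite mulr1.
(* This is the exact partial geometric sum, so the induction on [k] closes with an equality. *)
suff : ell2_norm (u (n + k)%N - u n) <= C / (1 - q) * (q ^+ n - q ^+ (n + k)).
  move=> /le_trans; apply; rewrite ler_wpM2l ?divr_ge0 ?subr_ge0 ?(ltW q1)//.
  by rewrite gerBl exprn_ge0.
elim: k => [|k IH]; first by rewrite addn0 !subrr mulr0 ell2_norm0.
have -> : u (n + k.+1)%N - u n = (u (n + k).+1 - u (n + k)%N) + (u (n + k)%N - u n).
  by rewrite addrA subrK addnS.
apply: le_trans (ell2_normD _ _) _; apply: le_trans (lerD (H _) IH) _.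
rewrite addnS exprS le_eqVlt; apply/orP; left; apply/eqP.
by field.
Qed.

(** Completeness in the form suited to iterates of a contraction, with the rate of convergence kept.
    The limit is taken coordinate by coordinate. *)
Lemma ell2_complete (u : nat -> ell2 R I) (q C : R) : 0 <= q < 1 ->
  (forall n, ell2_norm (u n.+1 - u n) <= C * q ^+ n) ->
  exists v : ell2 R I, forall n, ell2_norm (v - u n) <= C / (1 - q) * q ^+ n.
Proof.
move=> q01 /(ell2_telescope q01); set D := C / (1 - q) => H.
have D0 n : 0 <= D * q ^+ n by exact: le_trans (ell2_norm_ge0 _) (H n 0%N).
have Hi n k i : normc (u (n + k)%N i - u n i) <= D * q ^+ n.
  exact: le_trans (ell2_norm_coord (u (n + k)%N - u n) i) (H n k).
have ReB (x y : R[i]) : complex.Re (x - y) = complex.Re x - complex.Re y.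
  by case: x y => [? ?] [? ?].
have ImB (x y : R[i]) : complex.Im (x - y) = complex.Im x - complex.Im y.
  by case: x y => [? ?] [? ?].
have cRe i : cvgn (fun n => complex.Re (u n i)).
  apply: (geometric_cvg q01 (D := D)) => n k; apply: le_trans (Hi n k i).
  case: (u _ _) (u _ _) => [x y] [z t] /=; rewrite -sqrtr_sqr ler_wsqrtr//.
  by rewrite lerDl sqr_ge0.
have cIm i : cvgn (fun n => complex.Im (u n i)).
  apply: (geometric_cvg q01 (D := D)) => n k; apply: le_trans (Hi n k i).
  case: (u _ _) (u _ _) => [x y] [z t] /=; rewrite -sqrtr_sqr ler_wsqrtr//.
  by rewrite lerDr sqr_ge0.
pose v (i : I) : R[i] := (limn (fun n => complex.Re (u n i)) +i*
                          limn (fun n => complex.Im (u n i)))%C.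
pose vd n (i : I) : R[i] := v i - u n i.
(* As in Fatou's lemma: every finite partial sum for [u k - u n] obeys the bound when [n <= k], and
   a finite sum passes to the limit in [k]. *)
have vu n : (sqsum (vd n) <= ((D * q ^+ n) ^+ 2)%:E)%E.
  apply: ge_ereal_sup => _ [X [finX _] <-].
  rewrite fsumEFin// lee_fin fsbig_finite//=.
  have : \sum_(i <- finmap.enum_fset (fset_set X)) normc (u k i - u n i) ^+ 2 @[k --> \oo] -->
         \sum_(i <- finmap.enum_fset (fset_set X)) normc (v i - u n i) ^+ 2.
    apply: cvg_sumr => i; under eq_cvg do rewrite normc_sqr.
    rewrite normc_sqr; apply: cvgD.
    - under eq_cvg do rewrite ReB expr2.
      by rewrite ReB expr2; apply: cvgM; apply: cvgB;
        [exact: cRe|exact: cvg_cst|exact: cRe|exact: cvg_cst].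
    - under eq_cvg do rewrite ImB expr2.
      by rewrite ImB expr2; apply: cvgM; apply: cvgB;
        [exact: cIm|exact: cvg_cst|exact: cIm|exact: cvg_cst].
  move=> /cvgr_to_le; apply; exists n => // k /= nk.
  rewrite -(@fsbig_finite _ _ _ _ X (fun i => normc (u k i - u n i) ^+ 2))//.
  rewrite -lee_fin -fsumEFin//.
  apply: (@le_trans _ _ (sqsum (u k - u n))).
    by apply: ereal_sup_ubound; exists X.
  by rewrite sqsumE lee_fin ler_pXn2r ?nnegrE ?ell2_norm_ge0// -(subnKC nk).
have vS n : vd n \in @square_summable R I.
  by rewrite unfold_in /square_summable; apply: le_lt_trans (vu n) _; rewrite ltry.
have vS' : v \in @square_summable R I.
  have -> : v = (vd 0%N : I -> R[i]) + (u 0%N : I -> R[i]).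
    by apply/funext => i; rewrite /vd !ell2E subrK.
  by rewrite rpredD//; exact: (valP (u 0%N)).
exists (Ell2 vS') => n; rewrite -(@ler_pXn2r _ 2) ?nnegrE ?ell2_norm_ge0//.
by rewrite -lee_fin -sqsumE; exact: vu.
Qed.

End complete.

(** * Inversion by iterating a contraction *)

Section inverse.
Context {R : realType} {I : choiceType}.
Implicit Types (f g : ell2 R I) (l : R[i]).

(* The equation [T (T' w) = v] is the fixed point equation of the contraction
   [w |-> w - (T (T' w) - v) / K^2]. *)
Lemma normal_solve (T T' : ell2 R I -> ell2 R I) (K c : R) :
  {morph T : f g / f - g} -> {morph T' : f g / f - g} ->
  (forall f g, rdot (T f) g = rdot f (T' g)) ->
  (forall f, ell2_norm (T f) <= K * ell2_norm f) ->
  (forall f, c * ell2_norm f <= ell2_norm (T' f)) ->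
  0 < c -> c <= K ->
  forall v, exists w, T (T' w) = v.
Proof.
move=> Tb T'b adj TK cT' c0 cK v.
have K0 : 0 < K by exact: lt_le_trans cK.
pose k := real_complex R (K ^- 2).
pose S f := f - k *: T (T' f).
(* Here [|S f|^2 = |f|^2 - 2 k |T' f|^2 + k^2 |T (T' f)|^2]. The last term is at most [k |T' f|^2]
   by the bound on [T], and [k |T' f|^2 >= (c / K)^2 |f|^2] by the bound on [T'], so [S] contracts
   by [q]. The condition [c <= K] keeps the radicand nonnegative. *)
pose q := Num.sqrt (1 - (c / K) ^+ 2).
have cK1 : (c / K) ^+ 2 <= 1.
  have cK0 : 0 <= c / K by rewrite divr_ge0 ?ltW.
  by rewrite expr_le1// ler_pdivrMr// mul1r.
have qE : q ^+ 2 = 1 - (c / K) ^+ 2 by rewrite sqr_sqrtr// subr_ge0.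
have q01 : 0 <= q < 1.
  rewrite sqrtr_ge0/= -[ltRHS]sqrtr1 ltr_sqrt// gtrBl.
  by rewrite exprn_gt0// divr_gt0.
have Sq f : ell2_norm (S f) <= q * ell2_norm f.
  rewrite -(@ler_pXn2r _ 2)// ?nnegrE ?mulr_ge0 ?ell2_norm_ge0 ?sqrtr_ge0//.
  rewrite ell2_normBZ_sqr rdotC adj rdotff exprMn qE.
  have := TK (T' f); have := cT' f.
  have := ell2_norm_ge0 f; have := ell2_norm_ge0 (T' f).
  have := ell2_norm_ge0 (T (T' f)).
  move: (ell2_norm f) (ell2_norm (T' f)) (ell2_norm (T (T' f))) => a b d.
  move=> d0 b0 a0 ca dK.
  have d2 : d ^+ 2 <= K ^+ 2 * b ^+ 2.
    by rewrite -exprMn ler_pXn2r// nnegrE mulr_ge0// ltW.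
  have b2 : c ^+ 2 * a ^+ 2 <= b ^+ 2.
    by rewrite -exprMn ler_pXn2r// nnegrE mulr_ge0// ltW.
  have i0 : 0 < K ^- 2 by rewrite invr_gt0 exprn_gt0.
  have e1 : K ^- 2 * K ^+ 2 = 1 by rewrite mulVf// expf_eq0 gt_eqF.
  have e2 : (c / K) ^+ 2 = c ^+ 2 * K ^- 2 by rewrite exprMn exprVn.
  rewrite e2; move: (K ^- 2) i0 e1 => i i0; move: (K ^+ 2) d2 => j d2 e1.
  have h1 : i ^+ 2 * d ^+ 2 <= i * b ^+ 2.
    have -> : i * b ^+ 2 = i ^+ 2 * (j * b ^+ 2).
      rewrite -[LHS]mul1r -e1; ring.
    by rewrite ler_wpM2l// sqr_ge0.
  have h2 : i * (c ^+ 2 * a ^+ 2) <= i * b ^+ 2 by rewrite ler_wpM2l// ltW.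
  by lra.
have Sb f g : S f - S g = S (f - g).
  by rewrite /S T'b Tb scalerBr; exact: subrACA.
pose u := fix u n := if n is n'.+1 then S (u n') + k *: v else 0.
have uC n : ell2_norm (u n.+1 - u n) <= ell2_norm (u 1%N) * q ^+ n.
  elim: n => [|n IH]; first by rewrite subr0 mulr1.
  rewrite [u n.+2]/(S (u n.+1) + k *: v) [X in _ - X]/(S (u n) + k *: v).
  rewrite opprD addrACA subrr addr0 Sb exprSr mulrA mulrC.
  apply: le_trans (Sq _) _.
  rewrite ler_wpM2l// ?sqrtr_ge0//.
have [w wu] := ell2_complete q01 uC.
exists w.
have : ell2_norm (w - (S w + k *: v)) <= 0.
  set D := _ / _ in wu.
  (* The defect of [w] is [(w - u n.+1) + S (u n - w)], and each summand has norm at most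
     [D * q * q ^+ n]. *)
  apply: (@le0_geometric _ q (D * q *+ 2)) => // n.
  have -> : w - (S w + k *: v) = (w - u n.+1) + S (u n - w).
    have E (a b e d : ell2 R I) : a - (b + e) = a - (d + e) + (d - b).
      by rewrite !opprD !addrA addrAC (addrAC _ _ d) subrK addrAC.
    by rewrite -Sb; exact: E.
  apply: le_trans (ell2_normD _ _) _.
  have := wu n; rewrite ell2_normB => wn.
  have := le_trans (Sq (u n - w)) (ler_wpM2l (proj1 (andP q01)) wn).
  have := wu n.+1; rewrite exprS.
  by rewrite mulr2n; lra.
move=> w0; have /ell2_norm_eq0/eqP : ell2_norm (w - (S w + k *: v)) = 0.
  by apply: le_anti; rewrite w0 ell2_norm_ge0.
rewrite /S -addrA opprD addrA subrr add0r opprD opprK subr_eq0 => /eqP.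
have k0 : k != 0.
  apply/negP => /eqP /(congr1 (@complex.Re R)) /eqP.
  by rewrite /= invr_eq0 expf_eq0 gt_eqF.
by apply: (scalerI k0).
Qed.

End inverse.

(** * Symmetric operators *)

Section symmetric.
Context {R : realType} {I : choiceType}.
Implicit Types (f g : ell2 R I) (l : R[i]) (A : {linear ell2 R I -> ell2 R I}).

Definition rsym A := forall f g, rdot (A f) g = rdot f (A g).

Lemma self_adjoint_rsym A : self_adjoint A -> rsym A.
Proof. by move=> sa f g; rewrite !rdotE sa. Qed.

(** [|T' f|^2 = <T T' f, f> = <T' T f, f> = |T f|^2]. *)
Lemma normal_norm (T T' : ell2 R I -> ell2 R I) :
  (forall f g, rdot (T f) g = rdot f (T' g)) ->
  (forall f, T (T' f) = T' (T f)) ->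
  forall f, ell2_norm (T' f) = ell2_norm (T f).
Proof.
move=> adj comm f; apply/eqP; rewrite -(@eqrXn2 _ 2) ?ell2_norm_ge0//.
by rewrite -!rdotff [eqbRHS]adj -comm [eqbRHS]rdotC adj.
Qed.

Lemma bounded_below_resolvent A l (c : R) : bounded_op A -> rsym A -> 0 < c ->
  (forall f, c * ell2_norm f <= ell2_norm (A f - l *: f)) ->
  resolvent_set A l.
Proof.
move=> [M AM] sA c0 cA.
pose T f := A f - l *: f; pose T' f := A f - conjc l *: f.
have TB : {morph T : f g / f - g}.
  by move=> f g; rewrite /T linearB scalerBr; exact: subrACA.
have T'B : {morph T' : f g / f - g}.
  by move=> f g; rewrite /T' linearB scalerBr; exact: subrACA.
have adj f g : rdot (T f) g = rdot f (T' g).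
  by rewrite /T /T' rdotDl rdotDr rdotNl rdotNr sA rdotZ.
have comm f : T (T' f) = T' (T f).
  rewrite /T /T' !(linearB A) !(linearZ_LR A) !scalerBr !scalerA (mulrC l).
  exact: subrACA.
have norm f : ell2_norm (T' f) = ell2_norm (T f).
  exact: normal_norm adj comm f.
(* The summand [c] only serves to have [c <= K] for the contraction. *)
have TK f : ell2_norm (T f) <= (`|M| + normc l + c) * ell2_norm f.
  apply: le_trans (ell2_normD _ _) _; rewrite ell2_normN ell2_normZ -addrA mulrDl.
  apply: lerD; first by apply: le_trans (AM f) _; rewrite ler_wpM2r ?ell2_norm_ge0 ?ler_norm.
  by rewrite ler_wpM2r ?ell2_norm_ge0// lerDl ltW.
have cT' f : c * ell2_norm f <= ell2_norm (T' f) by rewrite norm; exact: cA.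
have cK : c <= `|M| + normc l + c by rewrite lerDr addr_ge0 ?normc_ge0.
have surj v : exists w, T w = v.
  have [w <-] := @normal_solve _ _ T T' (`|M| + normc l + c) c TB T'B adj TK cT' c0 cK v.
  by exists (T' w).
have inj : injective T.
  move=> f g fg; apply/eqP; rewrite -subr_eq0; apply/eqP/ell2_norm_eq0.
  apply: le_anti; rewrite ell2_norm_ge0 andbT -(pmulr_rle0 _ c0).
  by apply: le_trans (cA _) _; rewrite -/(T _) TB fg subrr ell2_norm0.
(* The preimages are chosen one by one; linearity of [B] comes from injectivity of [T], its bound
   [c^-1] from the lower bound on [T]. *)
pose B v := sval (cid (surj v)).
have TBK v : T (B v) = v by rewrite /B; case: cid.
have Blin : linear B.
  move=> a f g; apply: inj; rewrite TBK /T linearP scalerDr scalerA.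
  rewrite -{1}(TBK f) -{1}(TBK g) /T scalerBr scalerA (mulrC l).
  by rewrite opprD addrACA.
pose Bm := GRing.isLinear.Build _ _ _ _ B Blin.
pose BL : {linear ell2 R I -> ell2 R I} := HB.pack B Bm.
exists BL; split=> [|f|f].
- exists c^-1 => f; rewrite -ler_pdivrMl ?invr_gt0// invrK.
  by rewrite -[in leRHS](TBK f); exact: cA.
- by apply: inj; exact: TBK.
- exact: TBK.
Qed.

(** The strict inequality forces [f] to be nonzero, so approximate eigenvectors need no
    normalization. *)
Lemma spectrum_approx A l (e : R) : bounded_op A -> rsym A -> 0 < e ->
  spectrum A l -> exists f, ell2_norm (A f - l *: f) < e * ell2_norm f.
Proof.
move=> bA sA e0 lA; apply: contrapT => H; apply: lA.
apply: (bounded_below_resolvent bA sA e0) => f; rewrite leNgt; apply/negP => ef.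
by apply: H; exists f.
Qed.

Lemma approx_spectrum A l :
  (forall e : R, 0 < e ->
     exists f, ell2_norm (A f - l *: f) < e * ell2_norm f) -> spectrum A l.
Proof.
move=> H [B [[M BM] BA _]].
(* An inverse bounded by [M] gives [|f| <= |M| |A f - l f|], which this tolerance contradicts; the
   [1] keeps it defined when [M = 0]. *)
have [|f] := H (`|M| + 1)^-1; first by rewrite invr_gt0 ltr_wpDl.
rewrite ltr_pdivlMl ?ltr_wpDl// ltNge => /negP; apply.
rewrite -{1}(BA f); apply: le_trans (BM _) _.
by rewrite ler_wpM2r ?ell2_norm_ge0// (le_trans (ler_norm _))// lerDl.
Qed.

End symmetric.

(** * Finite sums of vectors and operators *)

Section sums.
Context {R : realType} {I : choiceType} {J : finType}.
Implicit Types (f g : ell2 R I) (P : pred J).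

Lemma ell2_norm_sum P (F : J -> ell2 R I) :
  ell2_norm (\sum_(j | P j) F j) <= \sum_(j | P j) ell2_norm (F j).
Proof.
elim/big_ind2 : _ => [|x f y g xf yg|//]; first by rewrite ell2_norm0.
exact: le_trans (ell2_normD _ _) (lerD xf yg).
Qed.

Lemma rdot_suml P (F : J -> ell2 R I) g :
  rdot (\sum_(j | P j) F j) g = \sum_(j | P j) rdot (F j) g.
Proof.
apply: (big_morph (fun f => rdot f g)) => [f k|]; first exact: rdotDl.
by rewrite /rdot add0r sub0r ell2_normN subrr mul0r.
Qed.

Lemma rdot_sumr P (F : J -> ell2 R I) g :
  rdot g (\sum_(j | P j) F j) = \sum_(j | P j) rdot g (F j).
Proof. by rewrite rdotC rdot_suml; apply: eq_bigr => j _; rewrite rdotC. Qed.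

Lemma bounded_sum P (F : J -> ell2 R I -> ell2 R I) :
  (forall j, exists M, forall f, ell2_norm (F j f) <= M * ell2_norm f) ->
  exists M, forall f, ell2_norm (\sum_(j | P j) F j f) <= M * ell2_norm f.
Proof.
move=> /choice [M FM]; exists (\sum_(j | P j) M j) => f.
rewrite mulr_suml; apply: le_trans (ell2_norm_sum _ _) _.
by apply: ler_sum => j _; exact: FM.
Qed.

End sums.

(** * Multiplication operators *)

Section multiplication.
Context {R : realType} {I : choiceType}.
Variables (V : I -> R) (Vb : exists M : R, forall i, `|V i| <= M).

Lemma mul_op_bounded : bounded_op (mul_op Vb).
Proof.
case: (Vb) => M VM; exists `|M| => f; apply: ell2_norm_le1 => // i.
rewrite normcM normc_real ler_wpM2r ?normc_ge0//.
exact: le_trans (VM i) (ler_norm _).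
Qed.

Lemma mul_op_rsym : rsym (mul_op Vb).
Proof.
move=> f g; apply: rdot_ext => i /=.
by case: (f i) (g i) => [z t] [u v] /=; ring.
Qed.

End multiplication.

(** * One-body operators, slice by slice *)

Section one_body_op.
Context {R : realType} {N : nat}.
Variables (i : 'I_N) (h : {linear ell2 R int -> ell2 R int}).
Hypothesis hb : bounded_op h.
Implicit Types f g : ell2 R {ffun 'I_N -> int}.

(** The configurations with [w i = 0] label the lines parallel to the [i]-th axis, each line
    once. *)
Lemma sqsum_slices f :
  sqsum f = \esum_(w in [set w : {ffun 'I_N -> int} | w i = 0]) sqsum (slice i f w).
Proof. by rewrite /sqsum (esum_slices i)// => z; rewrite lee_fin sqr_ge0. Qed.

Lemma slice_one_body f w : slice i (one_body i hb f) w = h (slice i f w).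
Proof. by apply: ell2P => x /=; rewrite slice_update updateE. Qed.

Lemma sliceD f g w : slice i (f + g) w = slice i f w + slice i g w.
Proof. exact: ell2P. Qed.

Lemma sliceN f w : slice i (- f) w = - slice i f w.
Proof. exact: ell2P. Qed.

Lemma one_body_bounded : bounded_op (one_body i hb).
Proof.
have [M hM] := hb; exists `|M| => f.
rewrite -(@ler_pXn2r _ 2) ?nnegrE ?mulr_ge0 ?ell2_norm_ge0//.
rewrite exprMn -lee_fin -sqsumE EFinM -sqsumE !sqsum_slices.
apply: esum_leZ => [|w|w]; rewrite ?sqr_ge0 ?sqsum_ge0//.
rewrite slice_one_body !sqsumE -EFinM lee_fin -exprMn.
rewrite ler_pXn2r ?nnegrE ?mulr_ge0 ?ell2_norm_ge0//.
by apply: le_trans (hM _) _; rewrite ler_wpM2r ?ell2_norm_ge0 ?ler_norm.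
Qed.

Lemma one_body_rsym : rsym h -> rsym (one_body i hb).
Proof.
move=> hs f g; set hf := one_body i hb f; set hg := one_body i hb g.
(* This is the polarized symmetry with the subtracted norms moved across, so both sides are sums
   over slices of nonnegative terms and [hs] applies to each slice. *)
have : (sqsum (hf + g)%R + sqsum (f - hg)%R = sqsum (f + hg)%R + sqsum (hf - g)%R)%E.
  rewrite !sqsum_slices -!esumD => [|*|*|*|*]; rewrite ?sqsum_ge0//.
  apply: eq_esum => w _; rewrite !sliceD !sliceN !slice_one_body !sqsumE.
  have := hs (slice i f w) (slice i g w); rewrite /rdot -!EFinD => E.
  by congr EFin; move: E; lra.
rewrite !sqsumE -!EFinD => -[]; rewrite /rdot.
lra.
Qed.

End one_body_op.

(** * Boundedness and symmetry of the Hamiltonian *)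

Section hamiltonian_op.
Context {R : realType} {h : {linear ell2 R int -> ell2 R int}}.
Variables (hb : bounded_op h) (Q : nat -> R) (Q0 : Q n @[n --> \oo] --> 0).

Lemma hamiltonian_bounded N : bounded_op (hamiltonian hb Q0 N).
Proof.
have [M1 H1] : exists M, forall f, ell2_norm (\sum_(i < N) one_body i hb f) <= M * ell2_norm f.
  by apply: bounded_sum => i; exact: one_body_bounded.
have [M2 H2] : exists M, forall f, ell2_norm (\sum_(i < N) \sum_(j < N | (i < j)%N)
    pair_interaction Q0 i j f) <= M * ell2_norm f.
  by apply: bounded_sum => i; apply: bounded_sum => j; exact: mul_op_bounded.
exists (M1 + M2) => f; rewrite mulrDl.
exact: le_trans (ell2_normD _ _) (lerD (H1 f) (H2 f)).
Qed.

Lemma hamiltonian_rsym N : self_adjoint h -> rsym (hamiltonian hb Q0 N).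
Proof.
move=> /self_adjoint_rsym hs f g; rewrite rdotDl rdotDr; congr (_ + _).
  rewrite rdot_suml rdot_sumr; apply: eq_bigr => i _.
  exact: one_body_rsym.
rewrite rdot_suml rdot_sumr; apply: eq_bigr => i _.
rewrite rdot_suml rdot_sumr; apply: eq_bigr => j _.
exact: mul_op_rsym.
Qed.

End hamiltonian_op.

(** * Finitely supported functions *)

Section truncation.
Context {R : realType} {I : choiceType}.
Implicit Types (f g : ell2 R I) (l : R[i]) (A : {linear ell2 R I -> ell2 R I}).

Definition finitely_supported f :=
  exists2 X : set I, finite_set X & forall i, f i != 0 -> X i.

(** Truncate [f] to a finite set [X] whose partial sum is within [e^2] of [|f|^2]; by Pythagoras the
    remainder has squared norm below [e^2]. *)
Lemma finitely_supported_dense f (e : R) : 0 < e ->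
  exists2 g, finitely_supported g & ell2_norm (f - g) <= e.
Proof.
move=> e0.
have e20 : 0 < e ^+ 2 by rewrite exprn_gt0.
have [_ [X [finX _] <-]] := ub_ereal_sup_adherent e20 (sqsum_fin_num f).
rewrite -[ereal_sup _]/(sqsum f) => fX.
have VX : exists M : R, forall i, `|\1_X i : R| <= M.
  by exists 1 => i; rewrite indicE ger0_norm; case: (i \in X).
exists (mul_op VX f).
  exists X => // i /=; rewrite indicE; case: (boolP (i \in X)) => [/set_mem//|_].
  by rewrite mul0r eqxx.
rewrite -(@ler_pXn2r _ 2) ?nnegrE ?ell2_norm_ge0 ?(ltW e0)//.
have split : ell2_norm f ^+ 2 = ell2_norm (mul_op VX f) ^+ 2 + ell2_norm (f - mul_op VX f) ^+ 2.
  have := @ell2_norm_comb0 R I [:: (1, f); (-1, mul_op VX f); (-1, f - mul_op VX f)].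
  rewrite !big_cons !big_nil /= => H; lapply H; first by lra.
  move=> i; rewrite !big_cons !big_nil /= !ell2E /= indicE.
  by case: (f i) => x y; case: (i \in X); rewrite !normc_sqr /=; ring.
have gX : (\sum_(i \in X) (normc (f i) ^+ 2)%:E <= (ell2_norm (mul_op VX f) ^+ 2)%:E)%E.
  rewrite -sqsumE; apply: ereal_sup_ubound; exists X => //.
  apply: eq_fsbigr => i iX /=.
  by rewrite indicE iX mul1r.
have := lt_le_trans fX gX; rewrite sqsumE -EFinB lte_fin; lra.
Qed.

Lemma finitely_supported_approx A l (e : R) : bounded_op A -> rsym A -> 0 < e ->
  spectrum A l ->
  exists2 f, finitely_supported f & ell2_norm (A f - l *: f) < e * ell2_norm f.
Proof.
move=> bA sA e0 lA.
have e20 : 0 < e / 2 by rewrite divr_gt0.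
have [f fe] := spectrum_approx bA sA e20 lA.
have [M AM] := bA; set K := `|M| + normc l.
have K0 : 0 <= K by rewrite addr_ge0 ?normc_ge0.
have TK g : ell2_norm (A g - l *: g) <= K * ell2_norm g.
  apply: le_trans (ell2_normD _ _) _; rewrite ell2_normN ell2_normZ mulrDl lerD2r.
  by apply: le_trans (AM g) _; rewrite ler_wpM2r ?ell2_norm_ge0 ?ler_norm.
have f0 : 0 < ell2_norm f.
  by rewrite -(pmulr_rgt0 _ e20); exact: le_lt_trans (ell2_norm_ge0 _) fe.
have Ke0 : 0 < K + e by rewrite ltr_wpDl.
(* Replacing [f] by [g] at distance [d] raises the defect by at most [K d] and lowers [e |f|] by at
   most [e d]. The slack between [e / 2] and [e] pays for both when [(K + e) d <= e / 2 * |f|]. *)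
have d0 : 0 < e / 2 * ell2_norm f / (K + e) by rewrite divr_gt0// mulr_gt0.
have [g gfin fg] := finitely_supported_dense f d0.
exists g => //.
move: fg; rewrite ler_pdivlMr// => fg.
have h1 : ell2_norm (A g - l *: g) <= ell2_norm (A f - l *: f) + K * ell2_norm (f - g).
  have := TK (g - f); rewrite ell2_normB.
  have -> : A (g - f) - l *: (g - f) = A g - l *: g - (A f - l *: f).
    by rewrite linearB scalerBr; exact: subrACA.
  move=> h; rewrite -{1}(subrK (A f - l *: f) (A g - l *: g)).
  by apply: le_trans (ell2_normD _ _) _; rewrite addrC lerD2l.
have h2 : ell2_norm f <= ell2_norm (f - g) + ell2_norm g.
  by rewrite -{1}(subrK g f) ell2_normD.
have h3 := ler_wpM2l (ltW e0) h2.
move: (ell2_norm _) (ell2_norm _) (ell2_norm _) (ell2_norm _) (ell2_norm _) fg h1 h3 fe => *.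
lra.
Qed.

End truncation.

Lemma finite_config_bound N (X : set {ffun 'I_N -> int}) : finite_set X ->
  exists L : nat, forall z, X z -> forall k, (`|z k|%N <= L)%N.
Proof.
move=> finX; exists (\max_(z <- finmap.enum_fset (fset_set X)) \max_(k < N) `|z k|%N)%N.
move=> z Xz k; apply: leq_trans (leq_bigmax_seq _ _ _) => //.
  exact: (@leq_bigmax _ (fun k => `|z k|%N) k).
by rewrite in_fset_set// inE.
Qed.

Lemma ell2_sumE (R : realType) (I : choiceType) (J : finType) (P : pred J)
    (F : J -> ell2 R I) i : (\sum_(j | P j) F j) i = \sum_(j | P j) F j i.
Proof. by apply: (big_morph (fun f : ell2 R I => f i)). Qed.

Lemma hamiltonianE (R : realType) (h : {linear ell2 R int -> ell2 R int})
    (hb : bounded_op h) (Q : nat -> R) (Q0 : Q n @[n --> \oo] --> 0) N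
    (f : ell2 R {ffun 'I_N -> int}) z :
  hamiltonian hb Q0 N f z = \sum_(i < N) h (slice i f z) (z i) +
    \sum_(i < N) \sum_(j < N | (i < j)%N) real_complex R (Q `|z i - z j|%N) * f z.
Proof.
rewrite /hamiltonian/= ell2E !ell2_sumE; congr (_ + _).
by apply: eq_bigr => i _; rewrite ell2_sumE.
Qed.

(** * Translated and product configurations *)

Section shift.
Context {R : realType} {N : nat}.
Local Notation config := {ffun 'I_N -> int}.
Implicit Types (f : ell2 R config) (x : int).

Definition config_shift x (z : config) : config := [ffun k => z k - x].

Lemma sqsum_shift x f : sqsum (fun z => f (config_shift x z)) = sqsum f.
Proof.
rewrite /sqsum -(@reindex_esum R _ _ setT setT (config_shift x)
  (fun z => (normc (f z) ^+ 2)%:E))//; split=> //.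
  move=> y z _ _ /ffunP yz; apply/ffunP => k; have := yz k.
  by rewrite !ffunE => /addIr.
move=> z _; exists (config_shift (- x) z) => //.
by apply/ffunP => k; rewrite !ffunE opprK addrK.
Qed.

Lemma shift_subproof x f :
  (fun z => f (config_shift x z)) \in @square_summable R config.
Proof.
by rewrite unfold_in /square_summable sqsum_shift; exact: (valP f).
Qed.

Definition shift x f : ell2 R config := Ell2 (shift_subproof x f).

Lemma ell2_norm_shift x f : ell2_norm (shift x f) = ell2_norm f.
Proof. by rewrite {1}/ell2_norm sqsum_shift. Qed.

(** All particles move by the same [x]: differences of positions are unchanged, and on each slice
    the shift is a translation, which commutes with [h]. *)
Lemma hamiltonian_shift (h : {linear ell2 R int -> ell2 R int})
    (hb : bounded_op h) (Q : nat -> R) (Q0 : Q n @[n --> \oo] --> 0) x f :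
  translation_invariant h ->
  hamiltonian hb Q0 N (shift x f) = shift x (hamiltonian hb Q0 N f).
Proof.
move=> hT; apply: ell2P => z.
rewrite -[RHS]/(hamiltonian hb Q0 N f (config_shift x z)) !hamiltonianE; congr (_ + _).
  apply: eq_bigr => i _; rewrite ffunE.
  have -> : slice i (shift x f) z = translate x (slice i f (config_shift x z)).
    apply: ell2P => y /=; congr (ell2_val f _); apply/ffunP => k.
    by rewrite !ffunE; case: eqP.
  by rewrite hT.
apply: eq_bigr => i _; apply: eq_bigr => j _; rewrite !ffunE.
by rewrite opprB addrA subrK.
Qed.

End shift.

(** * Tensor products and the interaction between two clusters *)

Section tensor.
Context {R : realType} {m n : nat}.
Local Notation config N := {ffun 'I_N -> int}.
Implicit Types (f : ell2 R (config m)) (g : ell2 R (config n)) (z : config (m + n)).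

Definition lpart z : config m := [ffun i => z (lshift n i)].
Definition rpart z : config n := [ffun j => z (rshift m j)].

Lemma esum_config (a : config (m + n) -> \bar R) (F : config m -> config n -> \bar R) :
  (forall z, a z = F (lpart z) (rpart z)) -> (forall x y, 0 <= F x y)%E ->
  \esum_(z in setT) a z = \esum_(x in setT) \esum_(y in setT) F x y.
Proof.
move=> aF F0; rewrite esum_esum//.
rewrite (@reindex_esum _ _ _ setT (setT `*`` (fun=> setT))
  (fun z => (lpart z, rpart z)) (fun p => F p.1 p.2)).
  by apply: eq_esum => z _; rewrite aF.
split=> //.
  move=> y z _ _ [/ffunP l /ffunP r]; apply/ffunP => k.
  case: (split_ordP k) => i ->; first by have := l i; rewrite !ffunE.
  by have := r i; rewrite !ffunE.
move=> [x y] _.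
exists [ffun k => match fintype.split k with inl i => x i | inr j => y j end] => //.
by congr pair; apply/ffunP => k; rewrite !ffunE ?(unsplitK (inl _)) ?(unsplitK (inr _)).
Qed.

(** Computed for the bare function, because square summability of the product is deduced from it.
    Summing over the right part first gives [|f x|^2 |g|^2]. *)
Lemma sqsum_tensor f g :
  sqsum (fun z => f (lpart z) * g (rpart z)) = ((ell2_norm f * ell2_norm g) ^+ 2)%:E.
Proof.
rewrite /sqsum (@esum_config _ (fun x y => (normc (f x * g y) ^+ 2)%:E))//; last first.
  by move=> x y; rewrite lee_fin sqr_ge0.
transitivity (\esum_(x in [set: config m])
  (normc ((real_complex R (ell2_norm g) *: f) x) ^+ 2)%:E).
  apply: eq_esum => x _.
  by rewrite -[LHS]/(sqsum (f x *: g)) sqsumE ell2_normZ /= ell2E normcM normc_real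
             ger0_norm ?ell2_norm_ge0// mulrC.
by rewrite -/(sqsum _) sqsumE ell2_normZ normc_real ger0_norm ?ell2_norm_ge0// mulrC.
Qed.

Lemma tensor_subproof f g :
  (fun z => f (lpart z) * g (rpart z)) \in @square_summable R (config (m + n)).
Proof. by rewrite unfold_in /square_summable sqsum_tensor ltry. Qed.

Definition tensor f g : ell2 R (config (m + n)) := Ell2 (tensor_subproof f g).

Lemma ell2_norm_tensor f g : ell2_norm (tensor f g) = ell2_norm f * ell2_norm g.
Proof.
by rewrite {1}/ell2_norm sqsum_tensor/= sqrtr_sqr ger0_norm// mulr_ge0 ?ell2_norm_ge0.
Qed.

Variables (h : {linear ell2 R int -> ell2 R int}) (hb : bounded_op h).
Variables (Q : nat -> R) (Q0 : Q n @[n --> \oo] --> 0).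

Local Notation H N := (hamiltonian hb Q0 N).

Lemma slice_tensorl f g z i :
  slice (lshift n i) (tensor f g) z = g (rpart z) *: slice i f (lpart z).
Proof.
apply: ell2P => x /=; rewrite ell2E mulrC; congr (ell2_val g _ * ell2_val f _).
  apply/ffunP => k; rewrite !ffunE; case: eqP => // /eqP.
  by rewrite eq_rlshift.
by apply/ffunP => k; rewrite !ffunE eq_lshift.
Qed.

Lemma slice_tensorr f g z j :
  slice (rshift m j) (tensor f g) z = f (lpart z) *: slice j g (rpart z).
Proof.
apply: ell2P => x /=; rewrite ell2E; congr (ell2_val f _ * ell2_val g _).
  apply/ffunP => k; rewrite !ffunE; case: eqP => // /eqP.
  by rewrite eq_lrshift.
by apply/ffunP => k; rewrite !ffunE eq_rshift.
Qed.

(** A one-body term sees only its own factor, the other being constant on the slice. The pairs split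
    into those inside either cluster, which complete the two smaller Hamiltonians, and the cross
    pairs, which form the last term. *)
Lemma hamiltonian_tensor f g z :
  H (m + n) (tensor f g) z =
  tensor (H m f) g z + tensor f (H n g) z +
  real_complex R (\sum_(i < m) \sum_(j < n) Q `|lpart z i - rpart z j|%N) * tensor f g z.
Proof.
rewrite -[tensor (H m f) g z]/(H m f (lpart z) * g (rpart z)).
rewrite -[tensor f (H n g) z]/(f (lpart z) * H n g (rpart z)) !hamiltonianE.
set l := lpart z; set r := rpart z.
have lE i : z (lshift n i) = l i by rewrite ffunE.
have rE j : z (rshift m j) = r j by rewrite ffunE.
have Hl i : h (slice (lshift n i) (tensor f g) z) (z (lshift n i)) =
    g r * h (slice i f l) (l i).
  by rewrite slice_tensorl linearZ /= ell2E lE.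
have Hr j : h (slice (rshift m j) (tensor f g) z) (z (rshift m j)) =
    f l * h (slice j g r) (r j).
  by rewrite slice_tensorr linearZ /= ell2E rE.
have TE : tensor f g z = f l * g r by [].
rewrite TE big_split_ord (eq_bigr _ (fun i _ => Hl i)) -mulr_sumr.
rewrite (eq_bigr _ (fun i _ => Hr i)) -mulr_sumr.
rewrite [in X in _ + X = _]big_split_ord/=.
(* A left index precedes every right index, so all [m * n] cross pairs appear here. *)
have -> : \sum_(i < m) \sum_(j < m + n | (i < j)%N)
      real_complex R (Q `|z (lshift n i) - z j|%N) * (f l * g r) =
    (\sum_(i < m) \sum_(j < m | (i < j)%N) real_complex R (Q `|l i - l j|%N) * f l) * g r +
    real_complex R (\sum_(i < m) \sum_(j < n) Q `|l i - r j|%N) * (f l * g r).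
  rewrite rmorph_sum /= !mulr_suml -big_split /=; apply: eq_bigr => i _.
  rewrite big_split_ord/= rmorph_sum /= !mulr_suml; congr (_ + _).
    by apply: eq_bigr => j _; rewrite !lE mulrA.
  by apply: eq_big => j; rewrite ?ltn_addr// => _; rewrite lE rE.
(* No left index exceeds a right one, so only pairs inside the right cluster remain. *)
have -> : \sum_(i < n) \sum_(j < m + n | (m + i < j)%N)
      real_complex R (Q `|z (rshift m i) - z j|%N) * (f l * g r) =
    f l * (\sum_(i < n) \sum_(j < n | (i < j)%N) real_complex R (Q `|r i - r j|%N) * g r).
  rewrite mulr_sumr; apply: eq_bigr => i _; rewrite big_split_ord/= big_pred0 => [|j].
    rewrite add0r mulr_sumr; apply: eq_big => j; first by rewrite ltn_add2l.
    by rewrite !rE mulrCA.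
  by apply/negbTE; rewrite -leqNgt (leq_trans (ltnW (ltn_ord j)))// leq_addr.
ring.
Qed.

(** Once the defects of the two factors are removed, what remains is multiplication by the cross
    interaction. It has [m * n] terms, each at most [d] wherever the product does not vanish. *)
Lemma hamiltonian_tensor_norm (a b : R[i]) (d : R) f g : 0 <= d ->
  (forall z i j, f (lpart z) != 0 -> g (rpart z) != 0 ->
    `|Q `|lpart z i - rpart z j|%N| <= d) ->
  ell2_norm (H (m + n) (tensor f g) - (a + b) *: tensor f g) <=
    ell2_norm (H m f - a *: f) * ell2_norm g +
    ell2_norm f * ell2_norm (H n g - b *: g) +
    (m * n)%:R * d * (ell2_norm f * ell2_norm g).
Proof.
move=> d0 Qd; set F := _ - _.
set F1 := tensor (H m f - a *: f) g; set F2 := tensor f (H n g - b *: g).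
have FE : F = F1 + F2 + (F - F1 - F2) by rewrite -(addrA F) -opprD [RHS]addrC subrK.
rewrite -!ell2_norm_tensor FE; apply: le_trans (ell2_normD _ _) _.
apply: lerD; first exact: ell2_normD.
apply: ell2_norm_le1 => [|z]; first by rewrite mulr_ge0.
have -> : (F - F1 - F2) z =
    real_complex R (\sum_(i < m) \sum_(j < n) Q `|lpart z i - rpart z j|%N) * tensor f g z.
  rewrite -[LHS]/(H (m + n) (tensor f g) z - (a + b) * tensor f g z
    - (H m f (lpart z) - a * f (lpart z)) * g (rpart z)
    - f (lpart z) * (H n g (rpart z) - b * g (rpart z))).
  rewrite hamiltonian_tensor.
  rewrite -[tensor (H m f) g z]/(H m f (lpart z) * g (rpart z)).
  rewrite -[tensor f (H n g) z]/(f (lpart z) * H n g (rpart z)).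
  rewrite -[tensor f g z]/(f (lpart z) * g (rpart z)).
  by move: (H m f _) (H n g _) => u v; ring.
rewrite normcM normc_real.
have [f0|f0] := eqVneq (f (lpart z)) 0; first by rewrite /= f0 mul0r normc0 !mulr0.
have [g0|g0] := eqVneq (g (rpart z)) 0; first by rewrite /= g0 mulr0 normc0 !mulr0.
rewrite ler_wpM2r ?normc_ge0//.
apply: le_trans (ler_norm_sum _ _ _) _.
apply: (@le_trans _ _ (\sum_(i < m) \sum_(j < n) d)).
  apply: ler_sum => i _; apply: le_trans (ler_norm_sum _ _ _) _.
  by apply: ler_sum => j _; exact: Qd.
by rewrite !sumr_const !card_ord -mulrnA mulnC mulr_natl.
Qed.

End tensor.

(** * Approximate eigenvectors of two distant clusters *)

Lemma spectrum_hamiltonian_add (R : realType)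
  (h : {linear ell2 R int -> ell2 R int}) (hb : bounded_op h)
  (Q : nat -> R) (Q0 : Q r @[r --> \oo] --> 0) (m n : nat) (a b : R[i]) :
  self_adjoint h -> translation_invariant h ->
  spectrum (hamiltonian hb Q0 m) a -> spectrum (hamiltonian hb Q0 n) b ->
  spectrum (hamiltonian hb Q0 (m + n)) (a + b).
Proof.
move=> hs hT sa sb; apply: approx_spectrum => e e0.
(* Both defects and the cross interaction get [e / 4] each; the remaining quarter makes the final
   inequality strict. *)
have e40 : 0 < e / 4 by rewrite divr_gt0.
have [f [X /finite_config_bound[L1 XL1] fX] fa] := finitely_supported_approx
  (hamiltonian_bounded hb Q0 m) (hamiltonian_rsym hb Q0 (N := m) hs) e40 sa.
have [g [Y /finite_config_bound[L2 YL2] gY] gb] := finitely_supported_approx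
  (hamiltonian_bounded hb Q0 n) (hamiltonian_rsym hb Q0 (N := n) hs) e40 sb.
(* The successor avoids a zero denominator and still gives [m * n * d <= e / 4]. *)
pose d := e / 4 / (m * n).+1%:R.
have d0 : 0 < d by rewrite divr_gt0.
have [r0 _ Qr] : \forall r \near \oo, `|Q r| <= d.
  have := Q0 => /cvgr0_norm_le; exact.
(* Left positions lie within [L1] of 0 and shifted right ones within [L2] of [x], so the clusters
   are at least [r0] apart. *)
pose x : int := (L1 + L2 + r0)%:Z.
exists (tensor f (shift x g)).
have Qd z i j : f (lpart z) != 0 -> shift x g (rpart z) != 0 ->
    `|Q `|lpart z i - rpart z j|%N| <= d.
  move=> /fX/XL1/(_ i) h1 /gY/YL2/(_ j); rewrite ffunE => h2.
  by apply: Qr => /=; move: h1 h2; rewrite /x; lia.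
apply: le_lt_trans (hamiltonian_tensor_norm hb Q0 a b (ltW d0) Qd) _.
rewrite hamiltonian_shift//.
have -> : shift x (hamiltonian hb Q0 n g) - b *: shift x g =
    shift x (hamiltonian hb Q0 n g - b *: g) by exact: ell2P.
rewrite ell2_norm_tensor !ell2_norm_shift.
have f0 : 0 < ell2_norm f.
  by rewrite -(pmulr_rgt0 _ e40); exact: le_lt_trans (ell2_norm_ge0 _) fa.
have g0 : 0 < ell2_norm g.
  by rewrite -(pmulr_rgt0 _ e40); exact: le_lt_trans (ell2_norm_ge0 _) gb.
have mnd : (m * n)%:R * d <= e / 4.
  by rewrite /d mulrCA ler_piMr ?(ltW e40)// ler_pdivrMr// mul1r ler_nat leqnSn.
have h1 : ell2_norm (hamiltonian hb Q0 m f - a *: f) * ell2_norm g <=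
    e / 4 * ell2_norm f * ell2_norm g by rewrite ler_wpM2r ?ltW.
have h2 : ell2_norm f * ell2_norm (hamiltonian hb Q0 n g - b *: g) <=
    ell2_norm f * (e / 4 * ell2_norm g) by rewrite ler_wpM2l ?ltW.
have h3 : (m * n)%:R * d * (ell2_norm f * ell2_norm g) <=
    e / 4 * (ell2_norm f * ell2_norm g) by rewrite ler_wpM2r// mulr_ge0 ?ltW.
have h4 : 0 < e * (ell2_norm f * ell2_norm g) by rewrite !mulr_gt0.
apply: le_lt_trans (lerD (lerD h1 h2) h3) _.
by move: (ell2_norm f) (ell2_norm g) h4 => p q h4; lra.
Qed.

Theorem proposition6p1 (R : realType)
  (h : {linear ell2 R int -> ell2 R int}) (h_bounded : bounded_op h)
  (h_sa : self_adjoint h) (h_ti : translation_invariant h)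
  (Q : nat -> R) (Q_cvg0 : Q r @[r --> \oo] --> 0)
  (N m : nat) (m_range : (1 <= m <= N - 1)%N) :
  [set a + b | a in spectrum (hamiltonian h_bounded Q_cvg0 m)
             & b in spectrum (hamiltonian h_bounded Q_cvg0 (N - m))]
  `<=` spectrum (hamiltonian h_bounded Q_cvg0 N).
Proof.
(* Configurations of the product are indexed by a literal sum, hence the rewriting. It also hits the
   [N] inside [N - m], which [addKn] restores. *)
have -> : N = (m + (N - m))%N by case/andP: m_range => *; lia.
rewrite addKn => _ [a sa [b sb <-]].
exact: spectrum_hamiltonian_add.
Qed.
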